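(* Let $(S,+,\ast)$ be an Ehresmann semigroupoid and let $(\mathcal{C},\leq_l,\leq_r)$ be a local biordered Ehresmann category. Let $C(\cdot)$ denote the construction sending an Ehresmann semigroupoid to its associated local biordered Ehresmann category, and $S(\cdot)$ the construction sending a local biordered Ehresmann category to its associated Ehresmann semigroupoid (both defined in the context). Then: (a) $S(C(S)) = (S,+,\ast)$ as Ehresmann semigroupoids (same underlying set, same composable pairs, same composition, same unary operations $+$ and $\ast$); (b) $C(S(\mathcal{C})) = (\mathcal{C},\leq_l,\leq_r)$ as local biordered Ehresmann categories (same underlying set, same set of objects, same domain and range maps, same composition, same two partial orders).
   Context: **Semigroupoid.** A semigroupoid is a triple $(S,S^{(2)},\star)$ with $S$ a set, $S^{(2)}\subseteq S\times S$ and $\star\colon S^{(2)}\to S$ such that for all $s,t,r\in S$: if either ($(s,t),(t,r)\in S^{(2)}$), or ($(s,t),(s\star t,r)\in S^{(2)}$), or ($(t,r),(s,t\star r)\in S^{(2)}$), then all of $(s,t),(t,r),(s\star t,r),(s,t\star r)$ lie in $S^{(2)}$ and $(s\star t)\star r=s\star(t\star r)$. Write $st=s\star t$; ''$st$ is defined'' means $(s,t)\in S^{(2)}$. **Ehresmann semigroupoid (two-sided).** A triple $(S,+,\ast)$ with $S$ a semigroupoid and unary operations $s\mapsto s^+$, $s\mapsto s^\ast$ on $S$ such that for all $s,t\in S$: (i) $s^+s$ and $ss^\ast$ are defined, $s^+s=s$ and $ss^\ast=s$; (ii) if $s^+t^+$ is defined, then $t^+s^+$ is defined and $s^+t^+=t^+s^+$;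 if $s^\ast t^\ast$ is defined, then $t^\ast s^\ast$ is defined and $s^\ast t^\ast=t^\ast s^\ast$; (iii) if $s^+t^+$ is defined, then $s^+t^+=(s^+t)^+$; if $s^\ast t^\ast$ is defined, then $s^\ast t^\ast=(st^\ast)^\ast$; (iv) if $st$ is defined, then $(st)^+=(st^+)^+$ and $(st)^\ast=(s^\ast t)^\ast$; (v) $s^+=(s^+)^\ast$ and $s^\ast=(s^\ast)^+$. (The products on the right-hand sides in (iii), (iv) are automatically defined.) Its set of projections is $U=\{s^+:s\in S\}=\{s^\ast:s\in S\}$. **Category.** A (small) category consists of sets $\mathcal{C}_0\subseteq\mathcal{C}$, maps $D,R\colon\mathcal{C}\to\mathcal{C}_0$ and a partial operation $\circ$ on $\mathcal{C}$, with $x\circ y$ defined iff $D(x)=R(y)$, such that: $D(x\circ y)=D(y)$ and $R(x\circ y)=R(x)$; $\circ$ is associative on composable triples; for $e\in\mathcal{C}_0$, $D(e)=e=R(e)$, and $x\circ e=x$, $e\circ y=y$ whenever $D(x)=e=R(y)$. **Local meet-semilattice.** A semigroupoid $X$ such that for every $e\in X$, $ee$ is defined and $ee=e$, and whenever $ef$ is defined, $fe$ is defined and $ef=fe$. Its partial order is: $e\leq f$ iff $ef$ is defined and $ef=e$. The operation is denoted $\wedge$ and is determined by $\leq$; a poset $(X,\le)$ is called a local meet-semilattice if $\le$ arises this way. **Ordered category.** $(\mathcal{C},\leq)$ with $\mathcal{C}$ a category and $\leq$ a partial order on $\mathcal{C}$ such that: $x\leq y$ implies $D(x)\leq D(y)$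 and $R(x)\leq R(y)$; if $x\leq y$, $x'\leq y'$ and $x\circ x'$, $y\circ y'$ are defined, then $x\circ x'\leq y\circ y'$. It has restrictions if for each $x\in\mathcal{C}$ and $e\in\mathcal{C}_0$ with $e\leq D(x)$ there is a unique $x|e\in\mathcal{C}$ with $x|e\leq x$ and $D(x|e)=e$. It has corestrictions if for each $x\in\mathcal{C}$ and $e\in\mathcal{C}_0$ with $e\leq R(x)$ there is a unique $e|x\in\mathcal{C}$ with $e|x\leq x$ and $R(e|x)=e$. **Local biordered Ehresmann category.** A triple $(\mathcal{C},\leq_l,\leq_r)$ with $\mathcal{C}$ a category such that: (1) $(\mathcal{C},\leq_l)$ is an ordered category with corestrictions; (2) $(\mathcal{C},\leq_r)$ is an ordered category with restrictions; (3) $\mathcal{C}_0$ is a local meet-semilattice with partial order $\leq$ and operation $\wedge$; (4) $\leq_l$ and $\leq_r$ both restrict to $\leq$ on $\mathcal{C}_0$; (5) $\leq_l\circ\leq_r$ and $\leq_r\circ\leq_l$ coincide as relations on $\mathcal{C}$, where $x\,(P\circ Q)\,y$ iff there is $z$ with $x\,P\,z$ and $z\,Q\,y$; (6) if $x\leq_l y$, $e\in\mathcal{C}_0$ and $D(x)\wedge e$ is defined, then $x|(D(x)\wedge e)\leq_l y|(D(y)\wedge e)$; (7) if $x\leq_r y$, $e\in\mathcal{C}_0$ and $e\wedge R(x)$ is defined, then $(e\wedge R(x))|x\leq_r(e\wedge R(y))|y$. (In (6), (7) the relevant meets with $D(y)$, $R(y)$ are automatically defined; restrictions are with respect to $\leq_r$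 and corestrictions with respect to $\leq_l$.) **Construction $C(S)$.** For an Ehresmann semigroupoid $(S,+,\ast)$ with projections $U$: $C(S)=S$ as a set, $C(S)_0=U$, $D(s)=s^\ast$, $R(s)=s^+$, $s\cdot t=st$ defined exactly when $s^\ast=t^+$; $s\leq_l t$ iff $s^+t$ is defined and $s^+t=s$; $s\leq_r t$ iff $ts^\ast$ is defined and $ts^\ast=s$. This is a local biordered Ehresmann category. **Construction $S(\mathcal{C})$.** For a local biordered Ehresmann category $(\mathcal{C},\leq_l,\leq_r)$: $S(\mathcal{C})=\mathcal{C}$ as a set; $(x,y)$ is composable iff $e=D(x)\wedge R(y)$ is defined, and then the composition is the pseudo-product $x\otimes y=(x|e)\circ(e|y)$; $x^+=R(x)$, $x^\ast=D(x)$. This is an Ehresmann semigroupoid. *)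

(* Defs.v *)
From mathcomp Require Import all_boot.
From mathcomp Require Import boolp classical_sets.

Set Implicit Arguments.
Unset Strict Implicit.
Unset Printing Implicit Defensive.

(* A partial binary operation on X is a map X -> X -> option X: "st is
   defined" is [isSome (op s t)], and [op s t = Some p] says that st is defined
   and equal to p. *)
Definition partial_op (X : Type) := X -> X -> option X.

Definition is_semigroupoid (X : Type) (op : partial_op X) : Prop :=
  forall s t r,
    (isSome (op s t) /\ isSome (op t r)) \/
    (exists p, op s t = Some p /\ isSome (op p r)) \/
    (exists q, op t r = Some q /\ isSome (op s q)) ->
    exists p q w, [/\ op s t = Some p, op t r = Some q,
                      op p r = Some w & op s q = Some w].

(* [omap plus (mul s t)] is (st)^+, defined exactly when st is. *)
Record is_ehresmann (X : Type) (mul : partial_op X) (plus star : X -> X) :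
    Prop := IsEhresmann {
  ehr_semigroupoid : is_semigroupoid mul;
  ehr_plus_mul : forall s, mul (plus s) s = Some s;
  ehr_mul_star : forall s, mul s (star s) = Some s;
  ehr_plusC : forall s t, isSome (mul (plus s) (plus t)) ->
    mul (plus s) (plus t) = mul (plus t) (plus s);
  ehr_starC : forall s t, isSome (mul (star s) (star t)) ->
    mul (star s) (star t) = mul (star t) (star s);
  ehr_plus_plus : forall s t, isSome (mul (plus s) (plus t)) ->
    mul (plus s) (plus t) = omap plus (mul (plus s) t);
  ehr_star_star : forall s t, isSome (mul (star s) (star t)) ->
    mul (star s) (star t) = omap star (mul s (star t));
  ehr_mul_plus : forall s t, isSome (mul s t) ->
    omap plus (mul s t) = omap plus (mul s (plus t));
  ehr_star_mul : forall s t, isSome (mul s t) ->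
    omap star (mul s t) = omap star (mul (star s) t);
  ehr_plusE : forall s, plus s = star (plus s);
  ehr_starE : forall s, star s = plus (star s) }.

Record ehresmann_semigroupoid (X : Type) := EhresmannSemigroupoid {
  mul : partial_op X;
  plus : X -> X;
  star : X -> X;
  ehresmannP : is_ehresmann mul plus star }.

(* Composition is written from right to left: xy is defined iff the domain of x
   is the range of y. *)
Record is_category (X : Type) (ob : set X) (dom cod : X -> X)
    (comp : partial_op X) : Prop := IsCategory {
  cat_dom_ob : forall x, ob (dom x);
  cat_cod_ob : forall x, ob (cod x);
  cat_compE : forall x y, isSome (comp x y) <-> dom x = cod y;
  cat_dom_comp : forall x y z, comp x y = Some z -> dom z = dom y;
  cat_cod_comp : forall x y z, comp x y = Some z -> cod z = cod x;
  cat_compA : forall x y z p q, comp x y = Some p -> comp y z = Some q ->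
    comp p z = comp x q;
  cat_ob_dom : forall e, ob e -> dom e = e;
  cat_ob_cod : forall e, ob e -> cod e = e;
  cat_comp_ob : forall x e, ob e -> dom x = e -> comp x e = Some x;
  cat_ob_comp : forall e y, ob e -> e = cod y -> comp e y = Some y }.

Record category (X : Type) := Category {
  ob : set X;
  dom : X -> X;
  cod : X -> X;
  comp : partial_op X;
  categoryP : is_category ob dom cod comp }.

(* A local meet-semilattice whose underlying set is the subset A of X, given as
   a partial operation on X that is undefined outside A. *)
Record is_local_meet_semilattice (X : Type) (A : set X) (m : partial_op X) :
    Prop := IsLocalMeetSemilattice {
  lms_closed : forall e f g, m e f = Some g -> [/\ A e, A f & A g];
  lms_semigroupoid : is_semigroupoid m;
  lms_idem : forall e, A e -> m e e = Some e;
  lms_comm : forall e f, isSome (m e f) -> m e f = m f e }.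

Record is_ordered_category (X : Type) (C : category X) (le : X -> X -> Prop) :
    Prop := IsOrderedCategory {
  oc_refl : forall x, le x x;
  oc_anti : forall x y, le x y -> le y x -> x = y;
  oc_trans : forall x y z, le x y -> le y z -> le x z;
  oc_dom : forall x y, le x y -> le (dom C x) (dom C y);
  oc_cod : forall x y, le x y -> le (cod C x) (cod C y);
  oc_comp : forall x y x' y' p q, le x y -> le x' y' ->
    comp C x x' = Some p -> comp C y y' = Some q -> le p q }.

Definition has_restrictions (X : Type) (C : category X) (le : X -> X -> Prop) :=
  forall x e, ob C e -> le e (dom C x) -> exists! z, le z x /\ dom C z = e.

Definition has_corestrictions (X : Type) (C : category X)
    (le : X -> X -> Prop) :=
  forall x e, ob C e -> le e (cod C x) -> exists! z, le z x /\ cod C z = e.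

(* The unique element satisfying P; undefined if there is no such element. *)
Definition the_unique (X : Type) (P : X -> Prop) : option X :=
  match pselect (exists! x, P x) with
  | left h => Some (sval (cid h))
  | right _ => None
  end.

(* x|e *)
Definition restriction (X : Type) (C : category X) (le : X -> X -> Prop)
    (x e : X) : option X :=
  the_unique (fun z => le z x /\ dom C z = e).

(* e|x *)
Definition corestriction (X : Type) (C : category X) (le : X -> X -> Prop)
    (e x : X) : option X :=
  the_unique (fun z => le z x /\ cod C z = e).

(* m is the meet operation of the objects. *)
Record is_lbec (X : Type) (C : category X) (lel ler : X -> X -> Prop)
    (m : partial_op X) : Prop := IsLbec {
  lbec_ordl : is_ordered_category C lel;
  lbec_corestr : has_corestrictions C lel;
  lbec_ordr : is_ordered_category C ler;
  lbec_restr : has_restrictions C ler;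
  lbec_lms : is_local_meet_semilattice (ob C) m;
  lbec_lel_ob : forall e f, ob C e -> ob C f -> (lel e f <-> m e f = Some e);
  lbec_ler_ob : forall e f, ob C e -> ob C f -> (ler e f <-> m e f = Some e);
  lbec_le_comp : forall x y,
    (exists z, lel x z /\ ler z y) <-> (exists z, ler x z /\ lel z y);
  lbec_restr_lel : forall x y e g, lel x y -> ob C e ->
    m (dom C x) e = Some g ->
    exists h a b, [/\ m (dom C y) e = Some h, restriction C ler x g = Some a,
                      restriction C ler y h = Some b & lel a b];
  lbec_corestr_ler : forall x y e g, ler x y -> ob C e ->
    m e (cod C x) = Some g ->
    exists h a b, [/\ m e (cod C y) = Some h, corestriction C lel g x = Some a,
                      corestriction C lel h y = Some b & ler a b] }.

(* Local biordered Ehresmann categories. The meet is not part of the data: it is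
   determined by the order (lemma [lms_meet_unique]). *)
Record lbe_category (X : Type) := LbeCategory {
  cat :> category X;
  lel : X -> X -> Prop;
  ler : X -> X -> Prop;
  lbecP : exists m, is_lbec cat lel ler m }.

Definition meet (X : Type) (C : lbe_category X) : partial_op X :=
  sval (cid (lbecP C)).

(* The associated category is [C_of] below: its objects are the projections
   [range plus], domain and range are star and plus. *)
Definition C_comp (X : Type) (S : ehresmann_semigroupoid X) : partial_op X :=
  fun s t => if `[< star S s = plus S t >] then mul S s t else None.

Definition C_lel (X : Type) (S : ehresmann_semigroupoid X) (s t : X) : Prop :=
  mul S (plus S s) t = Some s.

Definition C_ler (X : Type) (S : ehresmann_semigroupoid X) (s t : X) : Prop :=
  mul S t (star S s) = Some s.

(* (x|e)(e|y), where e is the meet of the domain of x and the range of y *)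
Definition pseudo_product (X : Type) (C : category X) (lel ler : X -> X -> Prop)
    (m : partial_op X) : partial_op X :=
  fun x y =>
    if m (dom C x) (cod C y) is Some e then
      match restriction C ler x e, corestriction C lel e y with
      | Some a, Some b => comp C a b
      | _, _ => None
      end
    else None.

Section Semigroupoid.
Variables (X : Type) (op : partial_op X) (H : is_semigroupoid op).

Lemma sgo1 s t r p q : op s t = Some p -> op t r = Some q ->
  exists w, op p r = Some w /\ op s q = Some w.
Proof.
move=> E1 E2; case: (H (s := s) (t := t) (r := r)); first by left; rewrite E1 E2.
by move=> p' [q' [w []]]; rewrite E1 E2 => -[<-] [<-]; exists w.
Qed.

Lemma sgo2 s t r p w : op s t = Some p -> op p r = Some w ->
  exists q, op t r = Some q /\ op s q = Some w.
Proof.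
move=> E1 E2; case: (H (s := s) (t := t) (r := r)).
  by right; left; exists p; rewrite E2.
by move=> p' [q [w' []]]; rewrite E1 => -[<-] ->; rewrite E2 => -[<-]; exists q.
Qed.

Lemma sgo3 s t r q w : op t r = Some q -> op s q = Some w ->
  exists p, op s t = Some p /\ op p r = Some w.
Proof.
move=> E1 E2; case: (H (s := s) (t := t) (r := r)).
  by right; right; exists q; rewrite E2.
move=> p [q' [w' [h1 h2 h3 h4]]]; exists p; split=> //.
by move: h2 h4; rewrite E1 => -[<-]; rewrite E2 h3.
Qed.

End Semigroupoid.

Lemma the_unique_some (X : Type) (P : X -> Prop) x :
  the_unique P = Some x <-> unique P x.
Proof.
rewrite /the_unique; case: pselect => [h|h]; last first.
  by split=> // u; case: h; exists x.
case: cid => y yP /=; split=> [[<-]//|[Px _]].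
by rewrite (yP.2 _ Px).
Qed.

Lemma the_unique_exists (X : Type) (P : X -> Prop) :
  (exists! x, P x) -> exists x, the_unique P = Some x /\ P x.
Proof.
by case=> x xP; exists x; split; [apply/the_unique_some | case: xP].
Qed.

Lemma lms_meet_unique (X : Type) (A : set X) (m m' : partial_op X) :
  is_local_meet_semilattice A m -> is_local_meet_semilattice A m' ->
  (forall e f, A e -> A f -> (m e f = Some e <-> m' e f = Some e)) ->
  forall e f, m e f = m' e f.
Proof.
have glb (n : partial_op X) e f g : is_local_meet_semilattice A n ->
    n e f = Some g -> n g e = Some g /\ n g f = Some g.
  move=> [cl sg id co] nef; have [Ae Af Ag] := cl _ _ _ nef.
  have [w [n1 n2]] := sgo1 sg (id _ Ae) nef.
  have [w' [n3 n4]] := sgo1 sg nef (id _ Af).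
  rewrite nef in n1; case: n1 => ?; subst w.
  rewrite nef in n4; case: n4 => ?; subst w'.
  by split=> //; rewrite -(co e g) // n2.
have lbd (n : partial_op X) e f h : is_local_meet_semilattice A n ->
    n h e = Some h -> n h f = Some h ->
    exists g, n e f = Some g /\ n h g = Some h.
  move=> [cl sg id co] h1 h2.
  by have [q [q1 q2]] := sgo2 sg h1 h2; exists q.
suff sub (n n' : partial_op X) e f g : is_local_meet_semilattice A n ->
    is_local_meet_semilattice A n' ->
    (forall e f, A e -> A f -> (n e f = Some e <-> n' e f = Some e)) ->
    n e f = Some g -> n' e f = Some g.
  move=> H H' HE e f; case E : (m e f) => [g|]; first by rewrite (sub _ _ _ _ _ H H' HE E).
  case E' : (m' e f) => [g|] //.
  rewrite -E; apply: (sub m' m) => // e' f' Ae Af; split=> h; exact/HE.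
move=> H H' HE nef.
have [Ae Af Ag] := lms_closed H nef.
have [g1 g2] := glb _ _ _ _ H nef.
have [g' [n1 n2]] := lbd n' e f g H' ((HE _ _ Ag Ae).1 g1) ((HE _ _ Ag Af).1 g2).
have [_ _ Ag'] := lms_closed H' n1.
have [g1' g2'] := glb _ _ _ _ H' n1.
have [g'' [n3 n4]] := lbd n e f g' H ((HE _ _ Ag' Ae).2 g1') ((HE _ _ Ag' Af).2 g2').
rewrite nef in n3; case: n3 => ?; subst g''.
rewrite n1; have n5 := (HE _ _ Ag' Ag).1 n4.
have := lms_comm H' (e := g') (f := g); rewrite n2 n5 => /(_ isT) [<-].
by [].
Qed.

Section FromSemigroupoid.
Variables (X : Type).
Implicit Types (op : partial_op X).

Lemma ehresmann_dual op (pl st : X -> X) :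
  is_ehresmann op pl st -> is_ehresmann (fun s t => op t s) st pl.
Proof.
move=> [sg a1 a2 a3 a4 a5 a6 a7 a8 a9 a10]; split=> //.
- move=> s t r h; case: (sg r t s).
    case: h => [[h1 h2]|[[p [h1 h2]]|[p [h1 h2]]]]; first by left.
      by right; right; exists p.
    by right; left; exists p.
  by move=> p [q [w [h1 h2 h3 h4]]]; exists q, p, w.
- by move=> s t h; rewrite a4.
- by move=> s t h; rewrite a3.
- by move=> s t h; rewrite a6.
- by move=> s t h; rewrite a5.
- by move=> s t h; rewrite a8.
- by move=> s t h; rewrite a7.
Qed.

Variables (op : partial_op X) (pl st : X -> X) (H : is_ehresmann op pl st).
Let sg := ehr_semigroupoid H.
Implicit Types s t r e f g p q : X.

Lemma plpl s : pl (pl s) = pl s.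
Proof. by have := ehr_starE H (pl s); rewrite -(ehr_plusE H). Qed.

Lemma projE e : range pl e <-> pl e = e.
Proof. by split=> [[s _ <-]|<-]; [exact: plpl | exists e]. Qed.

Lemma proj_st e : pl e = e <-> st e = e.
Proof.
split=> <-; first by rewrite -(ehr_plusE H).
by rewrite -(ehr_starE H).
Qed.

Lemma proj_idem e : pl e = e -> op e e = Some e.
Proof. by move=> eE; rewrite -{1}eE (ehr_plus_mul H). Qed.

Lemma proj_comm e f g : pl e = e -> pl f = f -> op e f = Some g ->
  op f e = Some g /\ pl g = g.
Proof.
move=> eE fE; rewrite -eE -fE => efE; split.
  by rewrite -(ehr_plusC H) efE.
have := ehr_plus_plus H (s := e) (t := pl f).
by rewrite plpl efE /= => /(_ isT) [].
Qed.

Lemma op_pl s t p : op s t = Some p ->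
  exists q, [/\ op s (pl t) = Some q, op q t = Some p & pl q = pl p].
Proof.
move=> E; have [q [E1 E2]] := sgo3 sg (ehr_plus_mul H t) E.
exists q; split=> //.
by have := @ehr_mul_plus _ _ _ _ H s t; rewrite E E1 /= => /(_ isT) [].
Qed.

Lemma pl_opl e t p : pl e = e -> op e t = Some p -> op e (pl t) = Some (pl p).
Proof.
move=> eE E; have [q [E1 _ _]] := op_pl E.
by rewrite -eE (ehr_plus_plus H) ?eE ?E ?E1.
Qed.

Lemma pl_op_le s t p : op s t = Some p -> op (pl s) (pl p) = Some (pl p).
Proof.
move=> E; have [w [E1 E2]] := sgo1 sg (ehr_plus_mul H s) E.
rewrite E in E1; case: E1 => ?; subst w.
by apply: pl_opl => //; exact: plpl.
Qed.

Lemma lel_intro e t s : pl e = e -> op e t = Some s -> op (pl s) t = Some s.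
Proof.
move=> eE E; have [q [E1 E2 _]] := op_pl E.
by move: E1; rewrite (pl_opl eE E) => -[->].
Qed.

Lemma lel_pl s t : op (pl s) t = Some s -> op (pl s) (pl t) = Some (pl s).
Proof. by move/pl_opl; rewrite plpl; apply. Qed.

Lemma lel_anti s t : op (pl s) t = Some s -> op (pl t) s = Some t -> s = t.
Proof.
move=> E1 E2; have E3 := lel_pl E1; have E4 := lel_pl E2.
have [E5 _] := proj_comm (plpl _) (plpl _) E3.
move: E4; rewrite E5 => -[E6].
by move: E1; rewrite E6 (ehr_plus_mul H) => -[].
Qed.

Lemma lel_trans s t r : op (pl s) t = Some s -> op (pl t) r = Some t ->
  op (pl s) r = Some s.
Proof.
move=> E1 E2; have [p [E3 E4]] := sgo3 sg E2 E1.
by move: E3; rewrite (lel_pl E1) => -[->].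
Qed.

Lemma lel_op s t s' t' p q : op (pl s) t = Some s -> op (pl s') t' = Some s' ->
  st s = pl s' -> op s s' = Some p -> op t t' = Some q ->
  op (pl p) q = Some p.
Proof.
move=> E1 E2 E3 E4 E5; apply: (@lel_intro (pl s)); first exact: plpl.
have [p0 [E6 E7]] := sgo3 sg E2 E4.
move: E6; rewrite -E3 (ehr_mul_star H) => -[?]; subst p0.
have [q0 [E8 E9]] := sgo2 sg E1 E7.
by move: E8; rewrite E5 => -[->].
Qed.

Lemma lel_corestr x e : pl e = e -> op e (pl x) = Some e ->
  exists z, [/\ op (pl z) x = Some z, pl z = e & op e x = Some z].
Proof.
move=> eE E; have [z [E3 _]] := sgo1 sg E (ehr_plus_mul H x).
exists z; split => //; first exact: (lel_intro eE E3).
by move: (pl_opl eE E3); rewrite E => -[].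
Qed.

End FromSemigroupoid.

Section COf.
Variables (X : Type) (S : ehresmann_semigroupoid X).
Let op := mul S.
Let pl := plus S.
Let st := star S.
Let H : is_ehresmann op pl st := ehresmannP S.
Let Hd := ehresmann_dual H.
Let sg := ehr_semigroupoid H.

Lemma range_plus_star : range (plus S) = range (star S).
Proof.
apply/seteqP; split=> _ [s _ <-].
  by exists (plus S s) => //; exact: esym (ehr_plusE H s).
by exists (star S s) => //; exact: esym (ehr_starE H s).
Qed.

Lemma C_compE s t p :
  C_comp S s t = Some p <-> st s = pl t /\ op s t = Some p.
Proof.
rewrite /C_comp; case: asboolP => h; last by split=> // -[].
by split=> [|[]].
Qed.

Lemma st_pl_defined s t : st s = pl t -> isSome (op s t).
Proof.
move=> E; have := ehr_mul_star H s; rewrite E => E1.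
by have [w [E2 _]] := sgo1 sg E1 (ehr_plus_mul H t); rewrite E2.
Qed.

Lemma C_is_category : is_category (range pl) st pl (C_comp S).
Proof.
have obE e : range pl e -> pl e = e /\ st e = e.
  by move/(projE H) => eE; split=> //; apply/(proj_st H).
split.
- by move=> x; exists (st x) => //; rewrite -(ehr_starE H).
- by move=> x; exists x.
- move=> x y; rewrite /C_comp; case: asboolP => h; last by split.
  by split=> // _; exact: st_pl_defined.
- move=> x y z /C_compE[E1 E2].
  have := ehr_star_mul H (s := x) (t := y); rewrite E2 E1 => /(_ isT) /=.
  by rewrite (ehr_plus_mul H) => -[].
- move=> x y z /C_compE[E1 E2].
  have := ehr_mul_plus H (s := x) (t := y); rewrite E2 -E1 => /(_ isT) /=.
  by rewrite (ehr_mul_star H) => -[].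
- move=> x y z p q /C_compE[E1 E2] /C_compE[E3 E4].
  have [w [E5 E6]] := sgo1 sg E2 E4.
  transitivity (Some w); last symmetry; apply/C_compE; split=> //.
    rewrite -E3; have := ehr_star_mul H (s := x) (t := y).
    by rewrite E2 E1 => /(_ isT) /=; rewrite (ehr_plus_mul H) => -[].
  rewrite E1; have := ehr_mul_plus H (s := y) (t := z).
  by rewrite E4 -E3 => /(_ isT) /=; rewrite (ehr_mul_star H) => -[].
- by move=> e /obE[].
- by move=> e /obE[].
- move=> x e /obE[e1 e2] E; apply/C_compE; rewrite e1; split=> //.
  by rewrite -E; exact: ehr_mul_star H x.
- move=> e y /obE[e1 e2] E; apply/C_compE; rewrite e2; split=> //.
  by rewrite E; exact: ehr_plus_mul H y.
Qed.

Definition C_cat : category X :=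
  @Category X (range (plus S)) (star S) (plus S) (C_comp S) C_is_category.

Definition C_meet : partial_op X :=
  fun e f => if `[< range pl e /\ range pl f >] then op e f else None.

Lemma C_meetE e f g :
  C_meet e f = Some g <-> [/\ pl e = e, pl f = f & op e f = Some g].
Proof.
rewrite /C_meet; case: asboolP => [[/(projE H) h1 /(projE H) h2]|h].
  by split=> [|[]].
by split=> // -[/(projE H) h1 /(projE H) h2]; case: h.
Qed.

Lemma C_meet_lms : is_local_meet_semilattice (range pl) C_meet.
Proof.
have clo e f g : C_meet e f = Some g -> pl g = g.
  by move=> /C_meetE[h1 h2 h3]; case: (proj_comm H h1 h2 h3).
split.
- move=> e f g h; have gg := clo _ _ _ h.
  by move/C_meetE: h => [h1 h2 _]; split; apply/(projE H).
- move=> s t r h.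
  suff [p [q [h1 h2]]] : exists p q, C_meet s t = Some p /\ C_meet t r = Some q.
    move: (h1) (h2) => /C_meetE[e1 e2 e3] /C_meetE[e4 e5 e6].
    have [w [e7 e8]] := sgo1 sg e3 e6.
    have gp := clo _ _ _ h1; have gq := clo _ _ _ h2.
    by exists p, q, w; split=> //; apply/C_meetE.
  case: h => [[]|[]].
  + case: (C_meet s t) => // p _; case: (C_meet t r) => // q _.
    by exists p, q.
  + move=> [p [h1]]; case h2 : (C_meet p r) => [w|] // _.
    move: (h1) (h2) => /C_meetE[e1 e2 e3] /C_meetE[e4 e5 e6].
    have [q [e7 e8]] := sgo2 sg e3 e6.
    by exists p, q; split=> //; apply/C_meetE.
  + move=> [q [h1]]; case h2 : (C_meet s q) => [w|] // _.
    move: (h1) (h2) => /C_meetE[e1 e2 e3] /C_meetE[e4 e5 e6].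
    have [p [e7 e8]] := sgo3 sg e3 e6.
    by exists p, q; split=> //; apply/C_meetE.
- by move=> e /(projE H) eE; apply/C_meetE; split=> //; exact: (proj_idem H).
- move=> e f; case h : (C_meet e f) => [g|] // _; symmetry; apply/C_meetE.
  by move/C_meetE : h => [h1 h2 /(proj_comm H h1 h2)[]].
Qed.

Lemma C_lelE x y : C_lel S x y <-> op (pl x) y = Some x. Proof. by []. Qed.
Lemma C_lerE x y : C_ler S x y <-> op y (st x) = Some x. Proof. by []. Qed.

Lemma C_restriction x e : pl e = e -> op (st x) e = Some e ->
  exists z, restriction C_cat (C_ler S) x e = Some z /\ op x e = Some z.
Proof.
move=> eE E; have eE' : st e = e by apply/(proj_st H).
have [z [z1 z2 z3]] := lel_corestr Hd eE' E.
exists z; split=> //; apply/the_unique_some; split=> //= z' [].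
by rewrite /C_ler => h1 h2; move: h1; rewrite h2 -/op z3 => -[].
Qed.

Lemma C_corestriction x e : pl e = e -> op e (pl x) = Some e ->
  exists z, corestriction C_cat (C_lel S) e x = Some z /\ op e x = Some z.
Proof.
move=> eE E; have [z [z1 z2 z3]] := lel_corestr H eE E.
exists z; split=> //; apply/the_unique_some; split=> //= z' [].
by rewrite /C_lel => h1 h2; move: h1; rewrite h2 -/op z3 => -[].
Qed.

Lemma C_is_lbec : is_lbec C_cat (C_lel S) (C_ler S) C_meet.
Proof.
have stst s : st (st s) = st s by exact: (plpl Hd).
have stpl s : st (pl s) = pl s by rewrite -(ehr_plusE H).
have plst s : pl (st s) = st s by rewrite -(ehr_starE H).
split.
- split=> //=.
  + exact: ehr_plus_mul H.
  + exact: (lel_anti H).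
  + exact: (lel_trans H).
  + by move=> x y h; apply/C_lelE; rewrite plst; exact: (pl_op_le Hd h).
  + by move=> x y h; apply/C_lelE; rewrite (plpl H); exact: (lel_pl H h).
  + move=> x y x' y' p q h1 h2 /C_compE[h3 h4] /C_compE[h5 h6].
    exact: (lel_op H h1 h2 h3 h4 h6).
- move=> x e /= /(projE H) eE; rewrite /C_lel -/pl -/op eE => E.
  have [z [z1 z2 z3]] := lel_corestr H eE E.
  exists z; split=> // z' [h1 h2].
  by move: h1; rewrite -/pl h2 z3 => -[].
- split=> //=.
  + exact: ehr_mul_star H.
  + exact: (lel_anti Hd).
  + exact: (lel_trans Hd).
  + by move=> x y h; apply/C_lerE; rewrite stst; exact: (lel_pl Hd h).
  + by move=> x y h; apply/C_lerE; rewrite stpl; exact: (pl_op_le H h).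
  + move=> x y x' y' p q h1 h2 /C_compE[h3 h4] /C_compE[h5 h6].
    exact: (lel_op Hd h2 h1 (esym h3) h4 h6).
- move=> x e /= /(projE H) /(proj_st H) eE; rewrite /C_ler -/st -/op eE => E.
  have eE' : pl e = e by apply/(proj_st H).
  have [E' _] := proj_comm H (plst x) eE' E.
  have [z [z1 z2 z3]] := lel_corestr Hd eE E.
  exists z; split=> // z' [h1 h2].
  by move: h1; rewrite -/st h2 z3 => -[].
- exact: C_meet_lms.
- move=> e f /= /(projE H) eE /(projE H) fE; rewrite /C_lel -/pl -/op eE.
  by split=> [h|/C_meetE[]//]; apply/C_meetE.
- move=> e f /= /(projE H) eE /(projE H) fE; rewrite /C_ler -/st -/op.
  have -> : st e = e by apply/(proj_st H).
  split=> [h|/C_meetE[_ _ h]]; last by case: (proj_comm H eE fE h).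
  by apply/C_meetE; split=> //; case: (proj_comm H fE eE h).
- move=> x y; split=> -[z [h1 h2]].
  + have [w [h3 h4]] := sgo3 sg h2 h1.
    exists w; split; first exact: (lel_intro Hd (stst z) h4).
    exact: (lel_intro H (plpl H x) h3).
  + have [w [h3 h4]] := sgo2 sg h2 h1.
    exists w; split; first exact: (lel_intro H (plpl H z) h4).
    exact: (lel_intro Hd (stst x) h3).
- move=> x y e g h /= /(projE H) eE /C_meetE[_ _ gE].
  have [_ plg] := proj_comm H (plst x) eE gE.
  have h1 : op (st x) (st y) = Some (st x) := pl_op_le Hd h.
  have [k [h2 h3]] := sgo2 sg h1 gE.
  have [_ plk] := proj_comm H (plst y) eE h2.
  have h4 : op (st x) g = Some g.
    have [w [e1 e2]] := sgo1 sg (proj_idem H (plst x)) gE.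
    by rewrite gE in e1; case: e1 => ?; subst w.
  have h5 : op (st y) k = Some k.
    have [w [e1 e2]] := sgo1 sg (proj_idem H (plst y)) h2.
    by rewrite h2 in e1; case: e1 => ?; subst w.
  have [a [a1 a2]] := C_restriction plg h4.
  have [b [b1 b2]] := C_restriction plk h5.
  exists k, a, b; split=> //; first exact/C_meetE.
  have a3 : op x e = Some a.
    have [p [p1 p2]] := sgo3 sg gE a2.
    by move: p1; rewrite (ehr_mul_star H) => -[?]; subst p.
  have b3 : op y e = Some b.
    have [p [p1 p2]] := sgo3 sg h2 b2.
    by move: p1; rewrite (ehr_mul_star H) => -[?]; subst p.
  apply: (lel_intro H (plpl H x)).
  have [q [q1 q2]] := sgo2 sg h a3.
  by move: q1; rewrite b3 => -[->].
- move=> x y e g h /= /(projE H) eE /C_meetE[_ _ gE].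
  have [_ plg] := proj_comm H eE (plpl H x) gE.
  have h1 : op (pl y) (pl x) = Some (pl x) := pl_op_le H h.
  have [k [h2 h3]] := sgo3 sg h1 gE.
  have [_ plk] := proj_comm H eE (plpl H y) h2.
  have h4 : op g (pl x) = Some g.
    have [w [e1 e2]] := sgo1 sg gE (proj_idem H (plpl H x)).
    by rewrite gE in e2; case: e2 => ?; subst w.
  have h5 : op k (pl y) = Some k.
    have [w [e1 e2]] := sgo1 sg h2 (proj_idem H (plpl H y)).
    by rewrite h2 in e2; case: e2 => ?; subst w.
  have [a [a1 a2]] := C_corestriction plg h4.
  have [b [b1 b2]] := C_corestriction plk h5.
  exists k, a, b; split=> //.
    by apply/C_meetE; split=> //; exact: (plpl H).
  have a3 : op e x = Some a.
    have [p [p1 p2]] := sgo2 sg gE a2.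
    by move: p1; rewrite (ehr_plus_mul H) => -[?]; subst p.
  have b3 : op e y = Some b.
    have [p [p1 p2]] := sgo2 sg h2 b2.
    by move: p1; rewrite (ehr_plus_mul H) => -[?]; subst p.
  apply: (lel_intro Hd (stst x)).
  have [q [q1 q2]] := sgo3 sg h a3.
  by move: q1; rewrite b3 => -[->].
Qed.

Definition C_of : lbe_category X :=
  @LbeCategory X C_cat (C_lel S) (C_ler S) (ex_intro _ C_meet C_is_lbec).

End COf.

Section SOf.
Variables (X : Type) (C : category X) (lel ler : X -> X -> Prop).
Variables (m : partial_op X) (H : is_lbec C lel ler m).
Let Hl := lbec_ordl H.
Let Hr := lbec_ordr H.
Let Hm := lbec_lms H.
Let Hc := categoryP C.
Let mg := lms_semigroupoid Hm.
Local Notation D := (dom C).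
Local Notation R := (cod C).
Local Notation restr := (restriction C ler).
Local Notation corestr := (corestriction C lel).
Implicit Types x y z e f g : X.

Let Dob x : ob C (D x). Proof. exact: cat_dom_ob Hc x. Qed.
Let Rob x : ob C (R x). Proof. exact: cat_cod_ob Hc x. Qed.

Lemma meet_lb e f g : m e f = Some g ->
  [/\ m g e = Some g, m g f = Some g, m e g = Some g & m f g = Some g].
Proof.
move=> E; have [Ae Af Ag] := lms_closed Hm E.
have [w [n1 n2]] := sgo1 mg (lms_idem Hm Ae) E.
have [w' [n3 n4]] := sgo1 mg E (lms_idem Hm Af).
rewrite E in n1; case: n1 => ?; subst w.
rewrite E in n4; case: n4 => ?; subst w'.
have n5 : m g e = Some g by rewrite -(lms_comm Hm (e := e)) n2.
have n6 : m f g = Some g by rewrite -(lms_comm Hm (e := g)) n3.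
by [].
Qed.

Lemma restrE x e z : restr x e = Some z -> ler z x /\ D z = e.
Proof. by move/the_unique_some => []. Qed.

Lemma corestrE e x z : corestr e x = Some z -> lel z x /\ R z = e.
Proof. by move/the_unique_some => []. Qed.

Lemma lel_obP e f : ob C e -> ob C f -> lel e f <-> m e f = Some e.
Proof. exact: lbec_lel_ob H e f. Qed.

Lemma ler_obP e f : ob C e -> ob C f -> ler e f <-> m e f = Some e.
Proof. exact: lbec_ler_ob H e f. Qed.

Lemma restrP x e : m e (D x) = Some e -> exists z, restr x e = Some z.
Proof.
move=> E; have [Ae _ _] := lms_closed Hm E.
have [|z [h _]] := the_unique_exists (lbec_restr H (x := x) Ae _).
  by apply/ler_obP.
by exists z.
Qed.

Lemma corestrP x e : m e (R x) = Some e -> exists z, corestr e x = Some z.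
Proof.
move=> E; have [Ae _ _] := lms_closed Hm E.
have [|z [h _]] := the_unique_exists (lbec_corestr H (x := x) Ae _).
  by apply/lel_obP.
by exists z.
Qed.

Lemma restr_uniq x z z' : ler z x -> ler z' x -> D z = D z' -> z = z'.
Proof.
move=> h1 h2 h3; have h4 := oc_dom Hr h1.
have [w [_ wU]] := lbec_restr H (Dob z) h4.
by rewrite -(wU z) // -(wU z').
Qed.

Lemma corestr_uniq x z z' : lel z x -> lel z' x -> R z = R z' -> z = z'.
Proof.
move=> h1 h2 h3; have h4 := oc_cod Hl h1.
have [w [_ wU]] := lbec_corestr H (Rob z) h4.
by rewrite -(wU z) // -(wU z').
Qed.

Lemma restr_intro x z : ler z x -> restr x (D z) = Some z.
Proof.
move=> h; apply/the_unique_some; split=> // z' [h1 h2].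
exact: (restr_uniq h h1).
Qed.

Lemma corestr_intro x z : lel z x -> corestr (R z) x = Some z.
Proof.
move=> h; apply/the_unique_some; split=> // z' [h1 h2].
exact: (corestr_uniq h h1).
Qed.

Lemma ler_D x y : ler x y -> m (D x) (D y) = Some (D x).
Proof. by move=> /(oc_dom Hr) /ler_obP; apply. Qed.
Lemma ler_R x y : ler x y -> m (R x) (R y) = Some (R x).
Proof. by move=> /(oc_cod Hr) /ler_obP; apply. Qed.
Lemma lel_D x y : lel x y -> m (D x) (D y) = Some (D x).
Proof. by move=> /(oc_dom Hl) /lel_obP; apply. Qed.
Lemma lel_R x y : lel x y -> m (R x) (R y) = Some (R x).
Proof. by move=> /(oc_cod Hl) /lel_obP; apply. Qed.

Local Notation pp := (pseudo_product C lel ler m).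

Lemma ppE x y z : pp x y = Some z <-> exists e a b,
  [/\ m (D x) (R y) = Some e, ler a x /\ D a = e, lel b y /\ R b = e
    & comp C a b = Some z].
Proof.
rewrite /pseudo_product; split.
  case E : (m (D x) (R y)) => [e|] //.
  case E1 : (restr x e) => [a|] //; case E2 : (corestr e y) => [b|] // h.
  by exists e, a, b; split=> //; [exact: restrE | exact: corestrE].
move=> [e [a [b [-> [h1 h2] [h3 h4]]]]].
by rewrite -{1}h2 (restr_intro h1) -h4 (corestr_intro h3).
Qed.

Lemma ppP x y e : m (D x) (R y) = Some e -> exists z, pp x y = Some z.
Proof.
move=> E; have [h1 h2 h3 h4] := meet_lb E.
have [a aE] := restrP h1; have [b bE] := corestrP h2.
have [a1 a2] := restrE aE; have [b1 b2] := corestrE bE.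
have : isSome (comp C a b) by apply/(cat_compE Hc); rewrite a2.
case cE : (comp C a b) => [z|] // _.
by exists z; apply/ppE; exists e, a, b.
Qed.

Lemma pp_meet x y z : pp x y = Some z -> exists e, m (D x) (R y) = Some e.
Proof. by case/ppE=> e [a [b [h _ _ _]]]; exists e. Qed.

Lemma ob_D e : ob C e -> D e = e. Proof. exact: cat_ob_dom Hc e. Qed.
Lemma ob_R e : ob C e -> R e = e. Proof. exact: cat_ob_cod Hc e. Qed.

Lemma pp_ob_l e x : ob C e -> forall z,
  pp e x = Some z <-> m e (R x) = Some (R z) /\ lel z x.
Proof.
move=> Ae z; split.
  case/ppE=> g [a [b [h [h1 h2] [h3 h4] h5]]].
  rewrite (ob_D Ae) in h; have [_ _ Ag] := lms_closed Hm h.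
  have [l1 l2 l3 l4] := meet_lb h.
  have ? : a = g.
    apply: (@restr_uniq e) => //; last by rewrite h2 ob_D.
    by apply/ler_obP.
  subst a; have := cat_ob_comp Hc Ag (esym h4); rewrite h5 => -[?]; subst b.
  by rewrite h4.
move=> [h1 h2]; apply/ppE; exists (R z), (R z), z; rewrite (ob_D Ae).
split=> //; first split.
- by have [l1 l2 l3 l4] := meet_lb h1; apply/ler_obP.
- exact: ob_D.
- exact: (cat_ob_comp Hc (Rob z)).
Qed.

Lemma pp_ob_r e x : ob C e -> forall z,
  pp x e = Some z <-> m (D x) e = Some (D z) /\ ler z x.
Proof.
move=> Ae z; split.
  case/ppE=> g [a [b [h [h1 h2] [h3 h4] h5]]].
  rewrite (ob_R Ae) in h; have [_ _ Ag] := lms_closed Hm h.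
  have [l1 l2 l3 l4] := meet_lb h.
  have ? : b = g.
    apply: (@corestr_uniq e) => //; last by rewrite h4 ob_R.
    by apply/lel_obP.
  subst b; have := cat_comp_ob Hc Ag h2; rewrite h5 => -[?]; subst a.
  by rewrite h2.
move=> [h1 h2]; apply/ppE; exists (D z), z, (D z); rewrite (ob_R Ae).
split=> //; last by apply: (cat_comp_ob Hc (Dob z)).
split; last exact: ob_R.
by have [l1 l2 l3 l4] := meet_lb h1; apply/lel_obP.
Qed.

Lemma pp_ob e f : ob C e -> ob C f -> pp e f = m e f.
Proof.
move=> Ae Af; case E : (m e f) => [g|].
  have [_ _ Ag] := lms_closed Hm E; have [l1 l2 l3 l4] := meet_lb E.
  by apply/pp_ob_l => //; rewrite (ob_R Af) (ob_R Ag); split=> //; apply/lel_obP.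
case E1 : (pp e f) => [z|] //.
by move/(pp_ob_l _ Ae): E1; rewrite (ob_R Af) E => -[].
Qed.

Lemma comp_restr x y z w : comp C x y = Some z -> ler w z ->
  exists a b, [/\ ler a x, ler b y, D b = D w, D a = R b &
                  comp C a b = Some w].
Proof.
move=> h1 h2.
have Dxy : D x = R y by apply/(cat_compE Hc); rewrite h1.
have h3 : m (D w) (D y) = Some (D w).
  by rewrite -(cat_dom_comp Hc h1); exact: ler_D.
have [b bE] := restrP h3; have [b1 b2] := restrE bE.
have h4 : m (R b) (D x) = Some (R b) by rewrite Dxy; exact: ler_R.
have [a aE] := restrP h4; have [a1 a2] := restrE aE.
have : isSome (comp C a b) by apply/(cat_compE Hc); rewrite a2.
case cE : (comp C a b) => [w'|] // _.
have ? : w' = w.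
  apply: (restr_uniq (x := z)) => //; first exact: (oc_comp Hr a1 b1 cE h1).
  by rewrite (cat_dom_comp Hc cE).
by subst w'; exists a, b.
Qed.

Lemma comp_corestr x y z w : comp C x y = Some z -> lel w z ->
  exists a b, [/\ lel a x, lel b y, R a = R w, D a = R b &
                  comp C a b = Some w].
Proof.
move=> h1 h2.
have Dxy : D x = R y by apply/(cat_compE Hc); rewrite h1.
have h3 : m (R w) (R x) = Some (R w).
  by rewrite -(cat_cod_comp Hc h1); exact: lel_R.
have [a aE] := corestrP h3; have [a1 a2] := corestrE aE.
have h4 : m (D a) (R y) = Some (D a) by rewrite -Dxy; exact: lel_D.
have [b bE] := corestrP h4; have [b1 b2] := corestrE bE.
have : isSome (comp C a b) by apply/(cat_compE Hc); rewrite b2.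
case cE : (comp C a b) => [w'|] // _.
have ? : w' = w.
  apply: (corestr_uniq (x := z)) => //; first exact: (oc_comp Hl a1 b1 cE h1).
  by rewrite (cat_cod_comp Hc cE).
by subst w'; exists a, b.
Qed.

Lemma pp_assoc s t r p q : pp s t = Some p -> pp t r = Some q ->
  exists w, pp p r = Some w /\ pp s q = Some w.
Proof.
move=> /ppE[e [u [v [eE [u1 u2] [v1 v2] pE]]]].
move=> /ppE[h [a [b [hE [a1 a2] [b1 b2] qE]]]].
have Dp : D p = D v := cat_dom_comp Hc pE.
have Rq : R q = R a := cat_cod_comp Hc qE.
have [f [fE fE']] := sgo1 mg (lel_D v1) hE.
have aR : m (R t) (R a) = Some (R a).
  by rewrite -(lms_comm Hm) (ler_R a1).
have [k [kE' kE]] := sgo1 mg eE aR.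
have [h' [w [a' [hE' /restrE[w1 w2] /restrE[a1' a2'] w3]]]] :=
  lbec_restr_lel H v1 (Rob r) fE.
rewrite hE in hE'; case: hE' => hh'.
have ? : a' = a by apply: (restr_uniq a1' a1); rewrite a2 a2' hh'.
subst a'.
have [e' [w' [v' [eE' /corestrE[w1' w2'] /corestrE[v1' v2'] w3']]]] :=
  lbec_corestr_ler H a1 (Dob s) kE.
rewrite eE in eE'; case: eE' => ee'.
have ? : v' = v by apply: (corestr_uniq v1' v1); rewrite v2 v2' ee'.
subst v'.
have Rww' : m (R w) (R w') = Some (R w).
  have := ler_R w1; rewrite v2 => l1.
  have [k' [l2 l3]] := sgo2 mg l1 (lel_R w3).
  by move: l2; rewrite kE' w2' => -[->].
have Dw'w : m (D w') (D w) = Some (D w').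
  have := lel_D w1'; rewrite a2 => l1.
  have [f' [l2 l3]] := sgo2 mg (ler_D w3') l1.
  by move: l2; rewrite fE' w2 => -[->].
have w'w : ler w' w.
  have [w'' w''E] := restrP Dw'w; have [l1 l2] := restrE w''E.
  by rewrite -(restr_uniq (oc_trans Hr l1 w1) w3' l2).
have ? : w' = w.
  apply: (corestr_uniq w1' w3).
  have := lms_comm Hm (e := R w) (f := R w').
  by rewrite Rww' (ler_R w'w) => /(_ isT) [].
subst w'.
have fp : m f (D p) = Some f by rewrite Dp; have [] := meet_lb fE.
have fr : m f (R r) = Some f by have [] := meet_lb fE.
have kq : m k (R q) = Some k by rewrite Rq; have [] := meet_lb kE.
have [P PE] := restrP fp; have [P1 P2] := restrE PE.
have [Q QE] := corestrP kq; have [Q1 Q2] := corestrE QE.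
have [c cE] := corestrP fr; have [c1 c2] := corestrE cE.
have [x [y [x1 y1 y2 xy PE']]] := comp_restr pE P1.
have ? : y = w by apply: (restr_uniq y1 w1); rewrite y2 P2 w2.
subst y.
have [y' [z [y1' z1 y2' yz QE']]] := comp_corestr qE Q1.
have ? : y' = w by apply: (corestr_uniq y1' w3); rewrite y2' Q2 w2'.
subst y'.
have zr : lel z r := oc_trans Hl z1 b1.
have ? : z = c by apply: (corestr_uniq zr c1); rewrite -yz w2 c2.
subst z.
have : isSome (comp C P c) by apply/(cat_compE Hc); rewrite P2 c2.
case WE : (comp C P c) => [W|] // _.
exists W; split; apply/ppE.
- by exists f, P, c; rewrite Dp.
- exists k, x, Q; rewrite Rq; split=> //.
  + by split; [exact: (oc_trans Hr x1 u1) | rewrite xy w2'].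
  + by rewrite -(cat_compA Hc PE' QE').
Qed.

Lemma pp_semigroupoid : is_semigroupoid pp.
Proof.
move=> s t r h.
suff [p [q [h1 h2]]] : exists p q, pp s t = Some p /\ pp t r = Some q.
  by have [w [h3 h4]] := pp_assoc h1 h2; exists p, q, w.
case: h => [[]|[]].
- case: (pp s t) => // p _; case: (pp t r) => // q _; by exists p, q.
- move=> [p [h1]]; case h2 : (pp p r) => [w|] // _.
  have [f fE] := pp_meet h2.
  case/ppE: (h1) => [e [a [b [eE _ [b1 b2] h3]]]].
  rewrite (cat_dom_comp Hc h3) in fE.
  have [h [hE _]] := sgo2 mg (lel_D b1) fE.
  by have [q qE] := ppP hE; exists p, q.
- move=> [q [h1]]; case h2 : (pp s q) => [w|] // _.
  have [f fE] := pp_meet h2.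
  case/ppE: (h1) => [e [a [b [eE [a1 a2] _ h3]]]].
  rewrite (cat_cod_comp Hc h3) in fE.
  have aR : m (R t) (R a) = Some (R a).
    by rewrite -(lms_comm Hm) (ler_R a1).
  have [h [hE _]] := sgo3 mg aR fE.
  by have [p pE] := ppP hE; exists p, q.
Qed.

Lemma pp_is_ehresmann : is_ehresmann pp R D.
Proof.
have RD x : R (D x) = D x by exact: ob_R.
have DR x : D (R x) = R x by exact: ob_D.
split=> //.
- exact: pp_semigroupoid.
- move=> s; apply/pp_ob_l => //.
  by split; [exact: (lms_idem Hm) | exact: (oc_refl Hl)].
- move=> s; apply/pp_ob_r => //.
  by split; [exact: (lms_idem Hm) | exact: (oc_refl Hr)].
- by move=> s t; rewrite !pp_ob //; exact: (lms_comm Hm).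
- by move=> s t; rewrite !pp_ob //; exact: (lms_comm Hm).
- move=> s t; rewrite pp_ob //; case E : (m (R s) (R t)) => [g|] // _.
  have [z zE] : exists z, pp (R s) t = Some z by apply: (ppP (e := g)); rewrite DR.
  by rewrite zE /=; case/(pp_ob_l _ (Rob s)): zE; rewrite E.
- move=> s t; rewrite pp_ob //; case E : (m (D s) (D t)) => [g|] // _.
  have [z zE] : exists z, pp s (D t) = Some z by apply: (ppP (e := g)); rewrite RD.
  by rewrite zE /=; case/(pp_ob_r _ (Dob t)): zE; rewrite E.
- move=> s t; case E : (pp s t) => [p|] // _.
  case/ppE: E => [e [a [b [eE [a1 a2] _ h3]]]].
  suff -> : pp s (R t) = Some a by rewrite /= (cat_cod_comp Hc h3).
  by apply/(pp_ob_r _ (Rob t)); rewrite a2.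
- move=> s t; case E : (pp s t) => [p|] // _.
  case/ppE: E => [e [a [b [eE _ [b1 b2] h3]]]].
  suff -> : pp (D s) t = Some b by rewrite /= (cat_dom_comp Hc h3).
  by apply/(pp_ob_l _ (Dob s)); rewrite b2.
Qed.

End SOf.

Lemma meetP (X : Type) (C : lbe_category X) :
  is_lbec C (lel C) (ler C) (meet C).
Proof. by rewrite /meet; case: cid. Qed.

Definition S_of (X : Type) (C : lbe_category X) : ehresmann_semigroupoid X :=
  @EhresmannSemigroupoid X (pseudo_product C (lel C) (ler C) (meet C))
    (cod C) (dom C) (pp_is_ehresmann (meetP C)).

(* Main.v *)
From mathcomp Require Import all_boot.
From mathcomp Require Import boolp classical_sets.
Require Import Defs.

Set Implicit Arguments.
Unset Strict Implicit.
Unset Printing Implicit Defensive.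

(** Why the two constructions are mutually inverse.

    In [C_of S] the restriction of [x] to a projection [e] is the product [xe],
    the corestriction of [y] to [e] is [ey], and the meet of two projections is
    their product.  The pseudo-product of [x] and [y] is therefore [(xe)(ey)]
    with [e = x^* y^+].  As [x x^* = x] and [y^+ y = y], associativity turns it
    into [xy]; the content is that each of the two sides is defined as soon as
    the other one is.  This is [pseudo_product_C_of].

    In [S_of C] the product with an object is a (co)restriction: [cod x] times
    [y] is the corestriction of [y] to the meet of [cod x] and [cod y].  So it
    equals [x] exactly when [lel x y] ([C_lel_S_of]), and dually for [ler]
    ([C_ler_S_of]).  When [dom x = cod y] the meet of the two is [dom x] itself,
    nothing gets restricted, and the pseudo-product is the composition
    ([C_comp_S_of]).

    The meet of a category is recovered from its order by a choice, so
    for [C_of S] it must first be identified with the product of projections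
    ([meet_C_of]), by uniqueness of meets. *)

(** Both kinds of structure carry proofs as well as operations.  Proof
    irrelevance reduces equality of structures to equality of the operations. *)
Lemma ehresmann_semigroupoid_eq (X : Type) (S T : ehresmann_semigroupoid X) :
  mul S = mul T -> plus S = plus T -> star S = star T -> S = T.
Proof.
case: S T => [m p s H] [m' p' s' H'] /= E1 E2 E3.
by subst m' p' s'; rewrite (Prop_irrelevance H H').
Qed.

Lemma lbe_category_eq (X : Type) (C E : lbe_category X) :
  ob C = ob E -> dom C = dom E -> cod C = cod E -> comp C = comp E ->
  lel C = lel E -> ler C = ler E -> C = E.
Proof.
case: C E => [[o d r c HC] l1 l2 H] [[o' d' r' c' HC'] l1' l2' H'] /=.
move=> E1 E2 E3 E4 E5 E6; subst o' d' r' c' l1' l2'.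
have EC := Prop_irrelevance HC HC'; subst HC'.
by rewrite (Prop_irrelevance H H').
Qed.

Lemma partial_op_eq (X : Type) (f g : partial_op X) :
  (forall x y z, f x y = Some z <-> g x y = Some z) -> f = g.
Proof.
move=> fg; apply/funext => x; apply/funext => y.
case E : (f x y) => [z|]; first by symmetry; apply/fg.
case E' : (g x y) => [z|] //.
by move/fg: E'; rewrite E.
Qed.

Section SemigroupoidRoundTrip.
Variables (X : Type) (S : ehresmann_semigroupoid X).
Let H : is_ehresmann (mul S) (plus S) (star S) := ehresmannP S.
Let Hd := ehresmann_dual H.
Let sg := ehr_semigroupoid H.

(** Both sides are meet operations on the projections, and both induce the order
    given by [C_lel S], which determines them. *)
Lemma meet_C_of : meet (C_of S) = C_meet S.
Proof.
have L := meetP (C_of S); have L' := C_is_lbec S.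
apply/funext => e; apply/funext => f.
apply: (lms_meet_unique (lbec_lms L) (lbec_lms L')) => e' f' Ae Af.
split=> h.
- by apply/(lbec_lel_ob L' Ae Af)/(lbec_lel_ob L Ae Af).
- by apply/(lbec_lel_ob L Ae Af)/(lbec_lel_ob L' Ae Af).
Qed.

Lemma pseudo_product_C_of :
  pseudo_product (C_of S) (C_lel S) (C_ler S) (C_meet S) = mul S.
Proof.
have plst s : plus S (star S s) = star S s by rewrite -(ehr_starE H).
have stpl s : star S (plus S s) = plus S s by rewrite -(ehr_plusE H).
apply: partial_op_eq => x y z; rewrite (ppE (C_is_lbec S)) /=; split.
- move=> [e [a [b [/C_meetE[_ _ eE] [xa sa] [yb pb] /C_compE[_ ab]]]]].
  rewrite /C_ler sa in xa; rewrite /C_lel pb in yb.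
  (* [xb = x(eb) = (xe)b = z], because [eb = b] *)
  have [b' [eb xb]] := sgo2 sg xa ab.
  move: eb; rewrite -pb (ehr_plus_mul H) => -[?]; subst b'.
  (* [xy] is defined, because [x^* y = x^* y^+ y = b] is *)
  have [b' [eb sy]] := sgo1 sg eE (ehr_plus_mul H y).
  move: eb; rewrite yb => -[?]; subst b'.
  have [w [xy xb']] := sgo1 sg (ehr_mul_star H x) sy.
  by rewrite xy -xb' xb.
- move=> xy.
  (* the factors are [b = x^* y] and [a = x b^+], where [b^+ = x^* y^+] *)
  have [b [sy xb]] := sgo2 sg (ehr_mul_star H x) xy.
  have [a [xa ab _]] := op_pl H xb.
  have sb : mul S (star S x) b = Some b.
    have [w [sy' sb]] := sgo1 sg (proj_idem H (plst x)) sy.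
    by rewrite sb -sy' sy.
  have sa : star S a = plus S b.
    have := pl_opl Hd (stpl b) xa.
    by rewrite (pl_opl H (plst x) sb) => -[].
  exists (plus S b), a, b; split.
  + apply/C_meetE; split=> //; first exact: (plpl H).
    exact: (pl_opl H (plst x) sy).
  + by split=> //; exact: (lel_intro Hd (stpl b) xa).
  + by split=> //; exact: (lel_intro H (plst x) sy).
  + exact/C_compE.
Qed.

Lemma S_of_C_of : S_of (C_of S) = S.
Proof.
apply: ehresmann_semigroupoid_eq => //=.
by rewrite meet_C_of pseudo_product_C_of.
Qed.

End SemigroupoidRoundTrip.

Section CategoryRoundTrip.
Variables (X : Type) (C : lbe_category X).
Let H := meetP C.
Let Hc := categoryP C.

Lemma range_cod : range (cod C) = ob C.
Proof.
apply/seteqP; split=> [_ [x _ <-]|e Ae]; first exact: cat_cod_ob Hc x.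
by exists e => //; exact: cat_ob_cod Hc e Ae.
Qed.

Lemma pseudo_product_comp x y : dom C x = cod C y ->
  pseudo_product C (lel C) (ler C) (meet C) x y = comp C x y.
Proof.
move=> xy; have : isSome (comp C x y) by apply/(cat_compE Hc).
case E : (comp C x y) => [z|] // _.
apply/(ppE H); exists (dom C x), x, y; split=> //.
- by rewrite -xy; apply: (lms_idem (lbec_lms H)); exact: cat_dom_ob Hc x.
- by split=> //; exact: oc_refl (lbec_ordr H) x.
- by split=> //; exact: oc_refl (lbec_ordl H) y.
Qed.

Lemma C_comp_S_of : C_comp (S_of C) = comp C.
Proof.
apply/funext => x; apply/funext => y; rewrite /C_comp /=.
case: asboolP => [|xy]; first exact: pseudo_product_comp.
case E : (comp C x y) => [z|] //; case: xy.
by apply/(cat_compE Hc); rewrite E.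
Qed.

Lemma C_lel_S_of : C_lel (S_of C) = lel C.
Proof.
apply/funext => x; apply/funext => y; apply/propext.
rewrite /C_lel /= (pp_ob_l H _ (cat_cod_ob Hc x)).
by split=> [[]//|xy]; split=> //; exact: (lel_R H xy).
Qed.

Lemma C_ler_S_of : C_ler (S_of C) = ler C.
Proof.
apply/funext => x; apply/funext => y; apply/propext.
rewrite /C_ler /= (pp_ob_r H _ (cat_dom_ob Hc x)).
split=> [[]//|xy]; split=> //.
(* the meet now comes in the order opposite to that of [ler_D] *)
have xyE := ler_D H xy.
by rewrite -(lms_comm (lbec_lms H)) xyE.
Qed.

Lemma C_of_S_of : C_of (S_of C) = C.
Proof.
apply: lbe_category_eq => //=.
- exact: range_cod.
- exact: C_comp_S_of.
- exact: C_lel_S_of.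
- exact: C_ler_S_of.
Qed.

End CategoryRoundTrip.

Theorem theorem2p28 (X Y : Type) (S : ehresmann_semigroupoid X)
    (C : lbe_category Y) :
  S_of (C_of S) = S /\ C_of (S_of C) = C.
Proof. by split; [exact: S_of_C_of | exact: C_of_S_of]. Qed.
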